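(* Let $G$ be a connected graph on $n$ vertices and let $k\ge 2$ be a natural number. Then $$SW_k(G)=\sum_{v\in V(G)} B_k(v)+(k-1)\binom{n}{k}.$$
   Context: All graphs are finite, simple and undirected. For a connected graph $G$ and $S\subseteq V(G)$, the Steiner diversity $\delta(S)$ is the minimum number of edges of a connected subgraph of $G$ whose vertex set contains $S$. A connected subgraph of $G$ whose vertex set contains $S$ and which has exactly $\delta(S)$ edges is a tree, called a Steiner tree on $S$ (a $k$-Steiner tree if $|S|=k$). The vertices in $S$ are its terminal vertices; its other vertices are its non-terminal vertices. For a natural number $k\ge 2$ the Steiner $k$-Wiener index of $G$ is $SW_k(G)=\sum_{S\subseteq V(G),\,|S|=k}\delta(S)$. The $k$-Steiner betweenness centrality of a vertex $v\in V(G)$ is $$B_k(v)=\sum_{\substack{A\subseteq V(G)\setminus\{v\}\\ |A|=k}}\frac{\sigma_A(v)}{\sigma_A},$$ where $\sigma_A$ is the number of all Steiner trees on $A$ in $G$ and $\sigma_A(v)$ is the number of all Steiner trees on $A$ in $G$ that include $v$ as a non-terminal vertex. *)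

(* Defs.v *)
From mathcomp Require Import all_boot all_order all_algebra.

Set Implicit Arguments.
Unset Strict Implicit.
Unset Printing Implicit Defensive.

Section Steiner.

(* A simple graph is a finite type of vertices with an adjacency relation [e],
   to be assumed symmetric and irreflexive; an edge is an unordered pair,
   encoded as the set of its two endpoints. *)
Variables (T : finType) (e : rel T).
Implicit Types (A : {set T}) (v : T).

Definition edges : {set {set T}} := [set [set p.1; p.2] | p : T * T & e p.1 p.2].

(* A pair (vertex set, edge set) is a candidate subgraph. *)
Definition pregraph : finType := ({set T} * {set {set T}})%type.
Implicit Types H : pregraph.

Definition vset H : {set T} := H.1.
Definition eset H : {set {set T}} := H.2.

Definition whole_graph : pregraph := ([set: T], edges).

Definition is_subgraph H : bool :=
  (eset H \subset edges) && [forall D in eset H, D \subset vset H].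

Definition is_connected H : bool :=
  [forall x in vset H, forall y in vset H,
     connect [rel a b | [set a; b] \in eset H] x y].

Definition spans A H : bool :=
  [&& is_subgraph H, is_connected H & A \subset vset H].

(* When the graph is connected, [whole_graph] satisfies [spans A], so this is
   a genuine minimum; otherwise the value may be meaningless. *)
Definition steiner_diversity A : nat :=
  #|eset [arg min_(H < whole_graph | spans A H) #|eset H| ]|.

Definition steiner_tree A H : bool :=
  spans A H && (#|eset H| == steiner_diversity A).

Definition steiner_wiener (k : nat) : nat :=
  \sum_(A : {set T} | #|A| == k) steiner_diversity A.

Definition sigma A : nat := #|[set H | steiner_tree A H]|.

Definition sigma_through A v : nat :=
  #|[set H | steiner_tree A H && (v \in vset H :\: A)]|.

Definition steiner_betweenness (k : nat) v : rat :=
  (\sum_(A : {set T} | (A \subset [set~ v]) && (#|A| == k))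
     (sigma_through A v)%:R / (sigma A)%:R)%R.

End Steiner.

(* Main.v *)
Require Import Defs.
From mathcomp Require Import all_boot all_order all_algebra.

Set Implicit Arguments.
Unset Strict Implicit.
Unset Printing Implicit Defensive.

Import GRing.Theory.
Local Open Scope ring_scope.

(** The formula is a double count of the pairs (Steiner tree on A, non-terminal
    vertex of that tree), one set A of k vertices at a time. Every Steiner tree
    on A has [steiner_diversity A] edges, hence one more vertex than that, and
    [steiner_diversity A - (k - 1)] of its vertices are non-terminal. Summing
    over the trees on A gives [sum_sigma_through]; after division by
    [sigma A], which is nonzero because G itself spans A, this says that A
    contributes [steiner_diversity A - (k - 1)] to the sum of the betweenness
    centralities. There are 'C(n, k) sets A.

    That a Steiner tree has one more vertex than edges is
    [steiner_tree_card_vset]: by [exists_spanning_tree], the edge set of a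
    connected graph on V contains #|V| - 1 edges that still connect V, and
    minimality of the Steiner tree forces these to be all of its edges. *)

(** Adjacency through an edge of [F], in the form used by [is_connected]. *)
Definition adj (T : finType) (F : {set {set T}}) : rel T :=
  [rel a b | [set a; b] \in F].

Lemma adj_connect_sym (T : finType) (F : {set {set T}}) :
  connect_sym (adj F).
Proof. by apply: sym_connect_sym => a b; rewrite /adj /= setUC. Qed.

Lemma connect_adjS (T : finType) (F F' : {set {set T}}) (x y : T) :
  F \subset F' -> connect (adj F) x y -> connect (adj F') x y.
Proof.
move=> /subsetP sFF'; apply: connect_sub => a b /sFF' Fab.
exact: connect1.
Qed.

Lemma exists_crossing_edge (T : finType) (F : {set {set T}}) (U : {set T})
    (x y : T) :
  connect (adj F) x y -> x \in U -> y \notin U ->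
  exists a b, [/\ [set a; b] \in F, a \in U & b \notin U].
Proof.
move=> cxy Ux nUy.
have [/existsP[a /existsP[b /and3P[]]]|noab] :=
  boolP [exists a, exists b, [&& [set a; b] \in F, a \in U & b \notin U]].
  by exists a, b.
have clU : closed (adj F) (mem U).
  apply: (intro_closed (@adj_connect_sym _ F)) => a b Fab Ua.
  apply: contraR noab => nUb.
  by apply/existsP; exists a; apply/existsP; exists b; apply/and3P; split.
by move: nUy; rewrite -[y \in U](closed_connect clU cxy) Ux.
Qed.

(** Growing a tree from the root [r], one vertex and one edge at a time; the
    clause that the edges of [F'] lie inside [U] guarantees that an edge
    leaving [U] is new. *)
Lemma exists_partial_tree (T : finType) (F : {set {set T}}) (V : {set T})
    (r : T) (m : nat) :
  r \in V -> (forall D, D \in F -> D \subset V) ->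
  (forall y, y \in V -> connect (adj F) r y) ->
  (m < #|V|)%N ->
  exists (U : {set T}) (F' : {set {set T}}),
    [/\ r \in U, U \subset V /\ #|U| = m.+1, F' \subset F /\ #|F'| = m,
        forall D, D \in F' -> D \subset U
      & forall y, y \in U -> connect (adj F') r y].
Proof.
move=> Vr FV cV; elim: m => [|m IHm] ltmV.
  exists [set r], set0; split.
  - by rewrite set11.
  - by rewrite sub1set cards1.
  - by rewrite sub0set cards0.
  - by move=> D; rewrite inE.
  - by move=> y /set1P->.
have [U [F' [Ur [sUV cardU] [sF'F cardF'] F'U cU]]] := IHm (ltnW ltmV).
have /subsetPn[y Vy nUy] : ~~ (V \subset U).
  by apply: contraL ltmV => /subset_leq_card; rewrite cardU -leqNgt.
have [a [b [Fab Ua nUb]]] := exists_crossing_edge (cV y Vy) Ur nUy.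
have Vb : b \in V by apply: (subsetP (FV _ Fab)); rewrite !inE eqxx orbT.
have nF'ab : [set a; b] \notin F'.
  by apply: contra nUb => /F'U/subsetP; apply; rewrite !inE eqxx orbT.
have cF' z : connect (adj F') r z -> connect (adj ([set a; b] |: F')) r z.
  exact/connect_adjS/subsetUr.
exists (b |: U), ([set a; b] |: F'); split.
- by rewrite inE Ur orbT.
- by rewrite subUset sub1set Vb sUV cardsU1 nUb cardU.
- by rewrite subUset sub1set Fab sF'F cardsU1 nF'ab cardF'.
- move=> D /setU1P[->|/F'U sDU].
    by apply/subsetP => z /set2P[] ->; rewrite !inE ?Ua ?eqxx ?orbT.
  exact/(subset_trans sDU)/subsetUr.
- move=> z /setU1P[->|/cU]; last exact: cF'.
  apply: connect_trans (cF' _ (cU a Ua)) (connect1 _).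
  by rewrite /adj /= setU11.
Qed.

(** A nonempty connected graph has a spanning connected subgraph with one edge
    less than vertices. *)
Lemma exists_spanning_tree (T : finType) (F : {set {set T}}) (V : {set T}) :
  V != set0 -> (forall D, D \in F -> D \subset V) -> is_connected (V, F) ->
  exists F' : {set {set T}},
    [/\ F' \subset F, #|F'|.+1 = #|V| & is_connected (V, F')].
Proof.
case/set0Pn => r Vr FV connV.
have cV y : y \in V -> connect (adj F) r y.
  by move=> Vy; move/forall_inP: connV => /(_ r Vr)/forall_inP/(_ y Vy).
have V_gt0 : (0 < #|V|)%N by rewrite (cardD1 r) Vr.
have ltV : (#|V|.-1 < #|V|)%N by rewrite prednK.
have [U [F' [_ [sUV cardU] [sF'F cardF'] _ cU]]] :=
  exists_partial_tree Vr FV cV ltV.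
have eqUV : U = V.
  by apply/eqP; rewrite eqEcard sUV cardU prednK //=.
exists F'; split; rewrite ?cardF' ?prednK //.
apply/forall_inP => x; rewrite /vset /= -eqUV => Ux.
apply/forall_inP => y Uy.
by apply: connect_trans (cU y Uy); rewrite [connect _ x r]adj_connect_sym cU.
Qed.

Section SteinerTrees.

Variables (T : finType) (e : rel T).
Hypothesis e_conn : is_connected (whole_graph e).
Implicit Types (A : {set T}) (H : pregraph T).

Lemma spans_whole_graph A : spans e A (whole_graph e).
Proof.
rewrite /spans e_conn subsetT /is_subgraph subxx !andbT /=.
by apply/forall_inP => D _; apply: subsetT.
Qed.

Lemma steiner_diversity_min A H :
  spans e A H -> (steiner_diversity e A <= #|eset H|)%N.
Proof.
rewrite /steiner_diversity.
by case: arg_minnP => [|H0 _ minH0]; [apply: spans_whole_graph | apply: minH0].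
Qed.

Lemma sigma_gt0 A : (0 < sigma e A)%N.
Proof.
apply/card_gt0P.
exists [arg min_(H < whole_graph e | spans e A H) #|eset H| ].
rewrite inE /steiner_tree /steiner_diversity eqxx andbT.
by case: arg_minnP => //; apply: spans_whole_graph.
Qed.

Lemma steiner_tree_card_vset A H :
  A != set0 -> steiner_tree e A H -> #|vset H| = (steiner_diversity e A).+1.
Proof.
case: H => V F nzA /andP[/and3P[/andP[/= sFe /forall_inP /= FV] conn sAV]].
move=> /eqP /= cardF.
have nzV : V != set0.
  by apply: contra_neq nzA => V0; apply/eqP; rewrite -subset0 -V0.
have [F' [sF'F cardF' conn']] := exists_spanning_tree nzV FV conn.
have spF' : spans e A (V, F').
  apply/and3P; split=> //; apply/andP; split; first exact: subset_trans sFe.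
  by apply/forall_inP => D /(subsetP sF'F); apply: FV.
have := steiner_diversity_min spF'.
have := subset_leq_card sF'F.
rewrite [X in (_ <= X)%N -> _]cardF => le1 le2.
by rewrite /vset /= -cardF'; congr _.+1; apply/eqP; rewrite eqn_leq le1 le2.
Qed.

(** Double count of the pairs of a Steiner tree on [A] and a non-terminal
    vertex of it; the terminal vertices are added on
    the left because subtraction in [nat] is truncated. *)
Lemma sum_sigma_through A :
  A != set0 ->
  (\sum_(v | v \notin A) sigma_through e A v + #|A|.-1 * sigma e A
   = steiner_diversity e A * sigma e A)%N.
Proof.
move=> nzA.
have -> : (\sum_(v | v \notin A) sigma_through e A v
           = \sum_(H | steiner_tree e A H) #|vset H :\: A|)%N.
  transitivity (\sum_(v | v \notin A)
      \sum_(H | steiner_tree e A H) (v \in vset H :\: A : nat))%N.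
    apply: eq_bigr => v _; rewrite /sigma_through -sum1_card big_mkcond.
    rewrite [RHS]big_mkcond; apply: eq_bigr => H _ /=.
    by rewrite inE; case: steiner_tree; case: (v \in _).
  rewrite exchange_big; apply: eq_bigr => H _ /=.
  rewrite -sum1_card big_mkcond [RHS]big_mkcond; apply: eq_bigr => v _ /=.
  by rewrite !inE; case: (v \in A); case: (v \in vset H).
have -> : sigma e A = (\sum_(H | steiner_tree e A H) 1)%N.
  by rewrite /sigma -sum1_card; apply: eq_bigl => H; rewrite inE.
rewrite !big_distrr -big_split /=; apply: eq_bigr => H tH; rewrite !muln1.
have sAH : A \subset vset H by case/andP: tH => /and3P[].
apply: succn_inj; rewrite -(steiner_tree_card_vset nzA tH) -addnS prednK ?card_gt0 //.
by rewrite -(cardsID A (vset H)) (setIidPr sAH) addnC.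
Qed.

Lemma sum_sigma_ratio A :
  A != set0 ->
  \sum_(v | v \notin A) (sigma_through e A v)%:R / (sigma e A)%:R
  = (steiner_diversity e A)%:R - (#|A|%:R - 1) :> rat.
Proof.
move=> nzA; rewrite -mulr_suml -natr_sum.
have nz : (sigma e A)%:R != 0 :> rat.
  by rewrite Num.Theory.pnatr_eq0 -lt0n sigma_gt0.
apply: (mulIf nz); rewrite divfK // mulrBl -natrM -(sum_sigma_through nzA).
have -> : #|A|%:R - 1 = #|A|.-1%:R :> rat.
  by rewrite -[in LHS](@prednK #|A|) ?card_gt0 // -natr1 addrK.
by rewrite natrD natrM addrK.
Qed.

End SteinerTrees.

Theorem theorem3 (T : finType) (e : rel T)
    (e_sym : symmetric e) (e_irrefl : irreflexive e)
    (e_conn : is_connected (whole_graph e))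
    (n : nat) (card_T : #|T| = n) (k : nat) (k_ge2 : (2 <= k)%N) :
  (steiner_wiener e k)%:R =
    \sum_(v : T) steiner_betweenness e k v + (k%:R - 1) * 'C(n, k)%:R :> rat.
Proof.
have -> : \sum_(v : T) steiner_betweenness e k v =
    \sum_(A : {set T} | #|A| == k)
      ((steiner_diversity e A)%:R - (k%:R - 1)) :> rat.
  rewrite /steiner_betweenness
    (exchange_big_dep (fun A : {set T} => #|A| == k)) /=; last first.
    by move=> v A _ /andP[].
  apply: eq_bigr => A cardA.
  have nzA : A != set0 by rewrite -card_gt0 (eqP cardA) (leq_trans _ k_ge2).
  rewrite -[in RHS](eqP cardA) -(sum_sigma_ratio e_conn nzA).
  apply: eq_bigl => v; rewrite cardA andbT.
  by rewrite -[[set~ v]]setTD subsetD1 subsetT.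
have cardk : #|[pred A : {set T} | #|A| == k]| = 'C(n, k).
  by rewrite -card_T -card_draws; apply: eq_card => A; rewrite !inE.
rewrite sumrB [X in _ - X + _]sumr_const cardk.
by rewrite mulr_natr subrK /steiner_wiener natr_sum.
Qed.
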